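(* Let $x(\cdot)$ be a solution of $\dot x(t)=f(t,x(t))$ on $[t_0,\infty)$, and let $E_\infty\subset\mathbb{R}^n$ be a nonempty closed set. Assume that $x(\cdot)$ is bounded, that $\mathrm{dist}(x(t),E(t))\to0$ as $t\to\infty$, and that $E(t)\to E_\infty$ in the Attouch–Wets sense as $t\to\infty$. Then $\mathrm{dist}(x(t),E_\infty)\to0$ as $t\to\infty$.
   Context: Fix $t_0\ge 0$ and $f:[t_0,\infty)\times\mathbb{R}^n\to\mathbb{R}^n$ such that $t\mapsto f(t,x)$ is measurable for every $x$ and $x\mapsto f(t,x)$ is locally Lipschitz for a.e. $t\ge t_0$. A solution is a locally absolutely continuous $x:[t_0,\infty)\to\mathbb{R}^n$ with $\dot x(t)=f(t,x(t))$ for a.e. $t\ge t_0$. For nonempty $S$, $\mathrm{dist}(x,S)=\inf_{y\in S}\|x-y\|$. The equilibrium sets are $E(t):=\{x\in\mathbb{R}^n: f(t,x)=0\}$, assumed nonempty and closed for every $t\ge t_0$. For nonempty closed $A,B$ and $R>0$, $d_R^{\rm AW}(A,B):=\sup_{\|z\|\le R}|\mathrm{dist}(z,A)-\mathrm{dist}(z,B)|$. $E(t)\to E_\infty$ in the Attouch–Wets sense means $d_R^{\rm AW}(E(t),E_\infty)\to0$ as $t\to\infty$ for every $R>0$. Standing assumption: there is a nonnegative $v_E\in L^1_{\mathrm{loc}}([t_0,\infty))$ such that for every $R>0$ and $t_0\le s\le t$, $d_R^{\rm AW}(E(t),E(s))\le\int_s^t v_E(\tau)\,d\tau$. *)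

(* Defs.v *)
From mathcomp Require Import all_boot all_order all_algebra.
From mathcomp Require Import all_classical all_reals all_analysis.
Import Order.TTheory GRing.Theory Num.Theory.
Import numFieldNormedType.Exports.

Set Implicit Arguments.
Unset Strict Implicit.
Unset Printing Implicit Defensive.

Local Open Scope classical_set_scope.
Local Open Scope ring_scope.

(* The canonical norm `|x| on 'rV[R]_n is the max-norm, so the Euclidean norm
   of R^n is defined separately.  Both induce the canonical topology of
   'rV[R]_n, which is the one used for [closed] and for derivatives below. *)
Definition enorm (R : realType) (n : nat) (x : 'rV[R]_n) : R :=
  Num.sqrt (\sum_(i < n) (x ord0 i) ^+ 2).

(* The real infimum is meaningful for nonempty S only (inf set0 = 0). *)
Definition dist (R : realType) (n : nat) (x : 'rV[R]_n) (S : set 'rV[R]_n) : R :=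
  inf [set enorm (x - y) | y in S].

(* For nonempty A and B and rho > 0 the set below is nonempty and bounded, by
   |dist(0, A) - dist(0, B)| + 2 rho, so that the real supremum is the true
   one. *)
Definition AWdist (R : realType) (n : nat) (rho : R) (A B : set 'rV[R]_n) : R :=
  sup [set `|dist z A - dist z B| | z in [set z | enorm z <= rho]].

Definition AWcvg (R : realType) (n : nat)
    (E : R -> set 'rV[R]_n) (Einf : set 'rV[R]_n) : Prop :=
  forall rho : R, 0 < rho -> AWdist rho (E t) Einf @[t --> +oo] --> (0 : R).

(* R with the sigma-algebra of Lebesgue measurable (not only Borel) sets,
   which is the domain of [completed_lebesgue_measure]. *)
Notation lebesgueType R := (caratheodory_type (@wlength R idfun)^*%mu).

(* Lebesgue-to-Borel measurability of maps into R^n. *)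
Definition lebesgue_measurable (R : realType) (n : nat)
    (D : set R) (g : R -> 'rV[R]_n) : Prop :=
  measurable_fun (D : set (lebesgueType R))
    (g : lebesgueType R -> g_sigma_algebraType (@open 'rV[R]_n)).

Definition locally_lipschitz (R : realType) (m n : nat)
    (g : 'rV[R]_m -> 'rV[R]_n) : Prop :=
  forall x, exists2 r : R, 0 < r & exists L : R,
    forall y z, enorm (y - x) < r -> enorm (z - x) < r ->
      enorm (g y - g z) <= L * enorm (y - z).

(* Standing assumptions on the right-hand side of x' = f(t, x). *)
Definition admissible_rhs (R : realType) (n : nat) (t0 : R)
    (f : R -> 'rV[R]_n -> 'rV[R]_n) : Prop :=
  (forall x, lebesgue_measurable `[t0, +oo[ (f ^~ x)) /\
  {ae completed_lebesgue_measure,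
    forall t : R, t0 <= t -> locally_lipschitz (f t)}.

Definition absolutely_continuous (R : realType) (n : nat) (a b : R)
    (x : R -> 'rV[R]_n) : Prop :=
  forall e : R, 0 < e -> exists2 d : R, 0 < d &
    forall (N : nat) (u v : 'I_N -> R),
      (forall i, [/\ a <= u i, u i <= v i & v i <= b]) ->
      trivIset setT (fun i => `]u i, v i[%classic) ->
      \sum_(i < N) (v i - u i) < d ->
      \sum_(i < N) enorm (x (v i) - x (u i)) < e.

Definition locally_absolutely_continuous (R : realType) (n : nat) (t0 : R)
    (x : R -> 'rV[R]_n) : Prop :=
  forall a b : R, t0 <= a -> a <= b -> absolutely_continuous a b x.

(* Trajectories are total functions on R; only their values on [t0, oo[ matter
   (t0 itself, where the two-sided derivative may fail to exist, is a null
   set). *)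
Definition solution (R : realType) (n : nat) (t0 : R)
    (f : R -> 'rV[R]_n -> 'rV[R]_n) (x : R -> 'rV[R]_n) : Prop :=
  locally_absolutely_continuous t0 x /\
  {ae completed_lebesgue_measure,
    forall t : R, t0 <= t -> is_derive t (1 : R) x (f t (x t))}.

Definition equilibria (R : realType) (n : nat)
    (f : R -> 'rV[R]_n -> 'rV[R]_n) (t : R) : set 'rV[R]_n :=
  [set x | f t x = 0].

(* L^1_loc([t0, oo[).  The library's [locally_integrable] requires an open
   domain, hence does not control the function near t0. *)
Definition L1loc (R : realType) (t0 : R) (v : R -> R) : Prop :=
  forall K : set R, compact K -> K `<=` [set` `[t0, +oo[] ->
    completed_lebesgue_measure.-integrable (K : set (lebesgueType R))
      (fun t => (v t)%:E).

Definition AW_variation_bound (R : realType) (n : nat) (t0 : R)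
    (E : R -> set 'rV[R]_n) (v : R -> R) : Prop :=
  forall rho s t : R, 0 < rho -> t0 <= s -> s <= t ->
    ((AWdist rho (E t) (E s))%:E <=
     \int[completed_lebesgue_measure]_(tau in `[s, t]) (v tau)%:E)%E.

(* Main.v *)
(* With rho bounding the trajectory, dist (x t) Einf is at most
   dist (x t) (E t) + AWdist rho (E t) Einf, and both terms vanish.  Only the
   boundedness of the set in the supremum AWdist has to be checked. *)
Require Import Defs.
From mathcomp Require Import all_boot all_order all_algebra.
From mathcomp Require Import all_classical all_reals all_analysis.
From mathcomp Require Import lra.
Import Order.TTheory GRing.Theory Num.Theory.
Import numFieldNormedType.Exports.

Local Open Scope classical_set_scope.
Local Open Scope ring_scope.

Lemma sum_sqr_ge0 (R : realType) (n : nat) (z : 'rV[R]_n) :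
  0 <= \sum_(i < n) (z ord0 i) ^+ 2.
Proof. by apply: sumr_ge0 => i _; exact: sqr_ge0. Qed.

Lemma enorm_ge0 (R : realType) (n : nat) (z : 'rV[R]_n) : 0 <= enorm z.
Proof. exact: sqrtr_ge0. Qed.

Lemma sqr_enorm (R : realType) (n : nat) (z : 'rV[R]_n) :
  enorm z ^+ 2 = \sum_(i < n) (z ord0 i) ^+ 2.
Proof. by rewrite sqr_sqrtr// sum_sqr_ge0. Qed.

(** Coordinatewise the two sides differ by [(z_i + a_i)^2], which is nonnegative. This crude bound
    stands in for the triangle inequality: only finiteness on balls is at stake, so the factor 2 is
    harmless. *)
Lemma sqr_enormB_le (R : realType) (n : nat) (z a : 'rV[R]_n) :
  enorm (z - a) ^+ 2 <= 2 * (enorm z ^+ 2 + enorm a ^+ 2).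
Proof.
rewrite !sqr_enorm -big_split/= mulr_sumr; apply: ler_sum => i _.
by rewrite !mxE; have := sqr_ge0 (z ord0 i + a ord0 i); nra.
Qed.

Lemma dist_ge0 (R : realType) (n : nat) (z : 'rV[R]_n) (A : set 'rV[R]_n) :
  A !=set0 -> 0 <= dist z A.
Proof.
move=> [a Aa]; apply: lb_le_inf; first by exists (enorm (z - a)), a.
by move=> _ [y _ <-]; exact: enorm_ge0.
Qed.

Lemma dist_le (R : realType) (n : nat) (z a : 'rV[R]_n) (A : set 'rV[R]_n) :
  A a -> dist z A <= enorm (z - a).
Proof.
move=> Aa; apply: ge_inf; last by exists a.
by exists 0 => _ [y _ <-]; exact: enorm_ge0.
Qed.

Lemma dist_bounded_on_ball (R : realType) (n : nat) (rho : R)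
    (A : set 'rV[R]_n) : A !=set0 ->
  exists K : R, forall z, enorm z <= rho -> dist z A <= K.
Proof.
(* The distance to [A] is at most the distance to the one point [a]; the witness is the square root
   of the previous bound with [enorm z] replaced by [rho]. *)
move=> [a Aa]; exists (Num.sqrt (2 * (rho ^+ 2 + enorm a ^+ 2))) => z zrho.
apply: (le_trans (dist_le _ _ z _ _ Aa)).
rewrite -[leLHS](ger0_norm (enorm_ge0 _ _ _)) -sqrtr_sqr ler_wsqrtr//.
apply: (le_trans (sqr_enormB_le _ _ _ _)).
by rewrite ler_pM2l// lerD2r lerXn2r// nnegrE ?enorm_ge0// (le_trans (enorm_ge0 _ _ z)).
Qed.

Lemma dist_sub_le_AWdist (R : realType) (n : nat) (rho : R)
    (A B : set 'rV[R]_n) (z : 'rV[R]_n) :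
  A !=set0 -> B !=set0 -> enorm z <= rho ->
  `|dist z A - dist z B| <= AWdist rho A B.
Proof.
move=> A0 B0 zrho.
have [KA hKA] := dist_bounded_on_ball _ _ rho _ A0.
have [KB hKB] := dist_bounded_on_ball _ _ rho _ B0.
apply: sup_ubound; last by exists z.
(* A difference of two nonnegative distances is at most their sum in absolute value. *)
exists (KA + KB) => _ [y /= yrho <-].
apply: (le_trans (ler_normB _ _)).
by rewrite !ger0_norm ?dist_ge0// lerD ?hKA ?hKB.
Qed.

Theorem theorem5p8 (R : realType) (n : nat) (t0 : R) (ht0 : 0 <= t0)
    (f : R -> 'rV[R]_n -> 'rV[R]_n) (hf : admissible_rhs t0 f)
    (hE : forall t : R, t0 <= t -> equilibria f t !=set0 /\ closed (equilibria f t))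
    (hvE : exists vE : R -> R,
       [/\ forall t : R, t0 <= t -> 0 <= vE t,
           L1loc t0 vE
         & AW_variation_bound t0 (equilibria f) vE])
    (x : R -> 'rV[R]_n) (hx : solution t0 f x)
    (Einf : set 'rV[R]_n) (hEinf0 : Einf !=set0) (hEinfcl : closed Einf)
    (hbd : [bounded enorm (x t) | t in [set t | t0 <= t]])
    (hdist : dist (x t) (equilibria f t) @[t --> +oo] --> (0 : R))
    (hAW : AWcvg (equilibria f) Einf) :
  dist (x t) Einf @[t --> +oo] --> (0 : R).
Proof.
have [rho rho0 xrho] : exists2 rho : R, 0 < rho &
    forall t, t0 <= t -> enorm (x t) <= rho.
  have [M [_ hM]] := hbd.
  (* [hM] gives a bound for every number strictly above [M]; [|M| + 1] is such a number and is also
     positive. *)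
  exists (`|M| + 1) => [|t t0t]; first by rewrite ltr_wpDl.
  rewrite -[leLHS](ger0_norm (enorm_ge0 _ _ _)); apply: hM => //.
  by rewrite (le_lt_trans (ler_norm M))// ltrDl.
have sum0 : dist (x t) (equilibria f t) + AWdist rho (equilibria f t) Einf
    @[t --> +oo] --> (0 : R).
  by rewrite -[X in _ --> X](addr0 0); apply: cvgD => //; exact: hAW.
apply: squeeze_cvgr sum0; last exact: cvg_cst.
near=> t.
(* Nonemptiness of the equilibrium set and the bound [rho] are available only from [t0] on. *)
have t0t : t0 <= t by near: t; apply: nbhs_pinfty_ge; exact: num_real.
have [E0 _] := hE t t0t.
(* The upper bound becomes a one-sided estimate of the difference of distances at the point [x t],
   which lies in the ball of radius [rho]. *)
rewrite dist_ge0//= -lerBlDl.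
apply: le_trans (dist_sub_le_AWdist _ _ _ _ _ _ E0 hEinf0 (xrho t t0t)).
by rewrite distrC ler_norm.
Unshelve. all: by end_near.
Qed.
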